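(* Let $p\in\mathbb{C}[t]$ be a nonconstant polynomial. Then the solution set $S_p=\{u\in C(\mathbb{R}) : p(\frac{d}{dt})u=0 \text{ in the sense of distributions}\}$ has the concatenability property if and only if $\deg p=1$.
   Context: $C(\mathbb{R})$ and $C^1(\mathbb{R})$ denote spaces of complex-valued functions on $\mathbb{R}$ that are continuous, respectively continuously differentiable. For $p=a_0+a_1t+\cdots+a_nt^n\in\mathbb{C}[t]$, $p(\frac{d}{dt})=a_0+a_1\frac{d}{dt}+\cdots+a_n\frac{d^n}{dt^n}$ acts on the space $\mathcal{D}'(\mathbb{R})$ of complex-valued distributions on $\mathbb{R}$; a function $u\in C(\mathbb{R})$ is identified with the regular distribution $\varphi\mapsto\int_{\mathbb{R}}u(t)\varphi(t)\,dt$, where $\varphi$ ranges over compactly supported $C^\infty$ functions. If $u_1,u_2\in S_p\cap C^1(\mathbb{R})$ satisfy $u_1(0)=u_2(0)$, their concatenation is the function in $C(\mathbb{R})$ equal to $u_1(t)$ for $t\le 0$ and to $u_2(t)$ for $t\ge 0$. The set $S_p$ has the concatenability property if, whenever $u_1,u_2\in S_p\cap C^1(\mathbb{R})$ and $u_1(0)=u_2(0)$, their concatenation belongs to $S_p$. *)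

(* Defs.v *)
From mathcomp Require Import all_boot all_order all_algebra.
From mathcomp Require Import complex.
From mathcomp Require Import all_classical all_reals all_analysis.
Set Implicit Arguments.
Unset Strict Implicit.
Unset Printing Implicit Defensive.
Import Order.TTheory GRing.Theory Num.Theory.
Import numFieldNormedType.Exports.

Local Notation Re := complex.Re.
Local Notation Im := complex.Im.

Local Open Scope complex_scope.
Local Open Scope classical_set_scope.
Local Open Scope ring_scope.

(* [R[i]^o] carries the topology of the complex modulus, so
   [continuous (u : R -> R[i]^o)] is the usual continuity of [u : R -> R[i]].
   Derivatives and integrals of a complex-valued function of a real variable
   are taken on real and imaginary parts, because [R[i]] is not a normed
   module over [R] in the library. *)

Section ComplexValued.
Variable R : realType.
Implicit Types (u v : R -> R[i]) (t : R).

Definition cderivable u t : Prop :=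
  derivable (fun s => Re (u s)) t 1 /\ derivable (fun s => Im (u s)) t 1.

Definition cderive u : R -> R[i] := fun t =>
  derive1 (fun s => Re (u s)) t +i* derive1 (fun s => Im (u s)) t.

Definition C1 u : Prop :=
  (forall t, cderivable u t) /\ continuous (cderive u : R -> R[i]^o).

Definition Cinfty u : Prop := forall n t, cderivable (iter n cderive u) t.

Definition csupp u : set R := closure [set t | u t != 0].

Definition cintegral u : R[i] :=
  (\int[@lebesgue_measure R]_(t in [set: R]) Re (u t)) +i*
  (\int[@lebesgue_measure R]_(t in [set: R]) Im (u t)).

Lemma ReD (z w : R[i]) : Re (z + w) = Re z + Re w.
Proof. by case: z w => [? ?] [? ?]. Qed.

Lemma ImD (z w : R[i]) : Im (z + w) = Im z + Im w.
Proof. by case: z w => [? ?] [? ?]. Qed.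

Lemma ReM (z w : R[i]) : Re (z * w) = Re z * Re w - Im z * Im w.
Proof. by case: z w => [? ?] [? ?]. Qed.

Lemma ImM (z w : R[i]) : Im (z * w) = Re z * Im w + Im z * Re w.
Proof. by case: z w => [? ?] [? ?]. Qed.

Lemma normc_ge_Im (z : R[i]) : `|Im z|%:C <= `|z|.
Proof.
case: z => a b; rewrite normc_def /= lecR -sqrtr_sqr ler_wsqrtr//.
by rewrite lerDr sqr_ge0.
Qed.

Lemma normc_le_ReIm (z : R[i]) : `|z| <= (`|Re z| + `|Im z|)%:C.
Proof.
case: z => a b; rewrite normc_def /= lecR.
rewrite -[leRHS]ger0_norm ?addr_ge0// -sqrtr_sqr ler_wsqrtr//.
rewrite sqrrD !real_normK ?num_real// -addrA [_ *+ 2 + _]addrC addrA lerDl.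
by rewrite mulrn_wge0// mulr_ge0.
Qed.

Lemma continuous_ReIm u : continuous (u : R -> R[i]^o) <->
  continuous (fun s => Re (u s)) /\ continuous (fun s => Im (u s)).
Proof.
split=> [uc|[rc ic] t].
  split=> t; apply/cvgrPdist_lt => e e0.
    have e0' : 0 < e%:C :> R[i]^o by rewrite ltcR.
    have /cvgrPdist_lt/(_ _ e0') := uc t.
    apply: filterS => s h; rewrite -ltcR; apply: le_lt_trans h.
    have := normc_ge_Re (u t - u s).
    by case: (u t) (u s) => [? ?] [? ?].
  have e0' : 0 < e%:C :> R[i]^o by rewrite ltcR.
  have /cvgrPdist_lt/(_ _ e0') := uc t.
  apply: filterS => s h; rewrite -ltcR; apply: le_lt_trans h.
  have := normc_ge_Im (u t - u s).
  by case: (u t) (u s) => [? ?] [? ?].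
apply/cvgrPdist_lt => e e0.
have [d d0 ed] : exists2 d : R, 0 < d & e = d%:C.
  exists (Re e); first by move: e0; rewrite ltcE => /andP[].
  by apply/esym/RRe_real/gtr0_real.
have d2 : 0 < d / 2 by rewrite divr_gt0.
have /cvgrPdist_lt/(_ _ d2) H1 := rc t.
have /cvgrPdist_lt/(_ _ d2) H2 := ic t.
apply: filterS2 H1 H2 => s h1 h2.
apply: (le_lt_trans (normc_le_ReIm _)); rewrite ed ltcR.
move: h1 h2; case: (u t) (u s) => [a b] [a' b'] /= h1 h2.
by rewrite [ltRHS](splitr d) ltrD.
Qed.

Lemma is_derive_lin (a b : R) (f g : R -> R) t :
  derivable f t 1 -> derivable g t 1 ->
  is_derive t (1 : R) (fun s => a * f s + b * g s) (a * derive1 f t + b * derive1 g t).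
Proof.
move=> fd gd; rewrite !derive1E.
have fD : is_derive t (1 : R) f ('D_1 f t) by apply: DeriveDef.
have gD : is_derive t (1 : R) g ('D_1 g t) by apply: DeriveDef.
have := is_deriveD (is_deriveZ a fD) (is_deriveZ b gD).
exact.
Qed.

Lemma cderive_lin (a : R[i]) u v t : cderivable u t -> cderivable v t ->
  cderivable (fun s => a * u s + v s) t /\
  cderive (fun s => a * u s + v s) t = a * cderive u t + cderive v t.
Proof.
case: a => a b [ur ui] [vr vi].
have lin3 (x y : R) (f g h : R -> R) :
    derivable f t 1 -> derivable g t 1 -> derivable h t 1 ->
    is_derive t (1 : R) (fun s => x * f s + y * g s + h s)
      (x * derive1 f t + y * derive1 g t + derive1 h t).
  move=> fd gd hd.
  apply: is_deriveD; first exact: is_derive_lin.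
  by rewrite derive1E; apply: DeriveDef.
have HR := lin3 a (- b) _ _ _ ur ui vr.
have HI := lin3 a b _ _ _ ui ur vi.
have ER : (fun s => Re ((a +i* b) * u s + v s)) =
  (fun s => a * Re (u s) + - b * Im (u s) + Re (v s)).
  by apply/funext => s; rewrite ReD ReM /= mulNr.
have EI : (fun s => Im ((a +i* b) * u s + v s)) =
  (fun s => a * Im (u s) + b * Re (u s) + Im (v s)).
  by apply/funext => s; rewrite ImD ImM.
rewrite /cderivable /cderive ER EI; split; first by case: HR HI => [? ?] [? ?].
rewrite [derive1 (fun s => a * Re _ + _ + _) t]derive1E.
rewrite [derive1 (fun s => a * Im _ + _ + _) t]derive1E.
rewrite (@derive_val _ _ _ _ _ _ _ HR) (@derive_val _ _ _ _ _ _ _ HI).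
apply/eqP; rewrite eq_complex !(ReD, ImD, ReM, ImM) /= !eqxx andbT//.
by rewrite mulNr eqxx.
Qed.

Lemma csuppP u t : ~ csupp u t -> \forall s \near t, u s = 0.
Proof.
move=> ncl.
have : ((~` closure [set t | u t != 0])°) t.
  have : open (~` closure [set t | u t != 0]).
    by rewrite openC; exact: closed_closure.
  by rewrite openE; apply.
rewrite interiorC => /= [] H.
apply: contrapT => Hn; apply: ncl => B Bt.
apply: contrapT => /set0P/negP; rewrite negbK => /eqP E.
apply: Hn; apply: filterS Bt => s Bs.
apply: contrapT => us; have : ([set t | u t != 0] `&` B) s.
  by split=> //=; apply/eqP.
by rewrite E.
Qed.

Lemma csupp_eq0 u t : ~ csupp u t -> u t = 0.
Proof. by move=> /csuppP/nbhs_singleton. Qed.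

Lemma csupp_cderive u : csupp (cderive u) `<=` csupp u.
Proof.
rewrite [X in _ `<=` X](closure_id _).1; last exact: closed_closure.
apply: closureS => t /= ut; apply: contrapT => /csuppP nt.
move/eqP: ut; apply; rewrite /cderive !derive1E.
rewrite (@near_eq_derive _ _ _ _ (cst 0)); last first.
  by apply: filterS nt => s ->.
rewrite (@near_eq_derive _ _ _ (fun s => Im (u s)) (cst 0)); last first.
  by apply: filterS nt => s ->.
by rewrite derive_cst.
Qed.

Lemma cderivable_continuous u :
  (forall t, cderivable u t) -> continuous (u : R -> R[i]^o).
Proof.
move=> ud; apply/continuous_ReIm; split=> t.
  by apply/differentiable_continuous/derivable1_diffP; case: (ud t).
by apply/differentiable_continuous/derivable1_diffP; case: (ud t).
Qed.

Lemma compact_sub_itv (K : set R) : compact K ->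
  exists2 A : R, 0 <= A & K `<=` `[- A, A].
Proof.
move=> /compact_bounded [M [_ HM]].
exists (`|M| + 1); first by rewrite addr_ge0.
move=> x Kx /=; rewrite in_itv /= -ler_norml; apply: HM => //.
by rewrite (le_lt_trans (ler_norm M))// ltrDl.
Qed.

Section CompactlySupportedIntegral.
Variables (A : R) (f : R -> R).
Hypotheses (A0 : 0 <= A) (fc : continuous f).
Hypothesis (fA : forall t, ~ `[- A, A]%classic t -> f t = 0).
Local Notation mu := (@lebesgue_measure R).

Let restrE : f \_ `[- A, A] = f.
Proof.
apply/funext => t; rewrite patchE; case: ifPn => //.
by rewrite notin_setE => /fA.
Qed.

Lemma integrable_itv_csupp : mu.-integrable `[- A, A] (EFin \o f).
Proof.
apply: continuous_compact_integrable; first exact: segment_compact.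
exact: continuous_subspaceT.
Qed.

Lemma integrable_csupp : mu.-integrable [set: R] (EFin \o f).
Proof.
have /integrable_mkcond := integrable_itv_csupp.
rewrite restrict_EFin restrE; apply; exact: measurable_itv.
Qed.

Lemma Rintegral_csupp_le (B : R) : (forall t, `|f t| <= B) ->
  `|\int[mu]_(t in [set: R]) f t| <= 2 * A * B.
Proof.
move=> fB; rewrite -[X in Rintegral _ _ X]restrE -Rintegral_mkcond.
have mI : measurable (`[- A, A]%classic : set (measurableTypeR R)).
  exact: measurable_itv.
apply: (le_trans (le_normr_Rintegral mI integrable_itv_csupp)).
apply: (@le_trans _ _ (\int[mu]_(t in `[- A, A]) (cst B t))).
  apply: le_Rintegral => //.
  - apply: continuous_compact_integrable; first exact: segment_compact.
    apply: continuous_subspaceT => t.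
    by apply: continuous_comp; [exact: fc|exact: norm_continuous].
  - apply: continuous_compact_integrable; first exact: segment_compact.
    by apply: continuous_subspaceT => t; exact: cst_continuous.
rewrite Rintegral_cst// [X in fine X](_ : _ = (2 * A)%:E) /=.
  by rewrite mulrC.
apply: etrans (lebesgue_measure_itv `[- A, A]) _.
rewrite /= lte_fin; case: ltP => [_|AA].
  by rewrite -EFinB opprK mulr_natl mulr2n.
have -> : A = 0.
  by apply/le_anti/andP; split=> //; rewrite -oppr_ge0 (le_trans A0).
by rewrite mulr0.
Qed.

End CompactlySupportedIntegral.

End ComplexValued.

Record testfun (R : realType) := TestFun {
  testfun_fun :> R -> R[i];
  testfun_smooth : Cinfty testfun_fun;
  testfun_compact : compact (csupp testfun_fun) }.

Section Distributions.
Variable R : realType.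
Local Notation mu := (@lebesgue_measure R).
Implicit Types (phi psi theta : testfun R).

Lemma testfun_deriv_smooth phi : Cinfty (cderive phi).
Proof. by move=> n t; rewrite -iterSr; exact: testfun_smooth. Qed.

Lemma testfun_deriv_compact phi : compact (csupp (cderive phi)).
Proof.
apply: subclosed_compact (@testfun_compact _ phi) _; last first.
  exact: csupp_cderive.
exact: closed_closure.
Qed.

Definition testfun_deriv phi : testfun R :=
  TestFun (@testfun_deriv_smooth phi) (@testfun_deriv_compact phi).

(* Linearity is phrased with the values of [theta], which spares a vector space
   structure on [testfun R]. Continuity is the seminorm estimate on each compact
   set, equivalent to continuity for the usual topology on test functions. *)
Record distribution := Distribution {
  distribution_fun :> testfun R -> R[i];
  distribution_linear : forall (a : R[i]) phi psi theta,
    (forall t, theta t = a * phi t + psi t) ->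
    distribution_fun theta = a * distribution_fun phi + distribution_fun psi;
  distribution_continuous : forall K : set R, compact K ->
    exists (N : nat) (c : R), forall phi (M : R), csupp phi `<=` K ->
      (forall j t, (j <= N)%N -> `|iter j (@cderive R) phi t| <= M%:C) ->
      `|distribution_fun phi| <= (c * M)%:C }.

Section Derivative.
Variable T : distribution.

Definition distr_deriv_fun phi : R[i] := - T (testfun_deriv phi).

Lemma distr_deriv_linear (a : R[i]) phi psi theta :
  (forall t, theta t = a * phi t + psi t) ->
  distr_deriv_fun theta = a * distr_deriv_fun phi + distr_deriv_fun psi.
Proof.
move=> E; rewrite /distr_deriv_fun mulrN -opprD; congr (- _).
apply: distribution_linear => t /=.
have -> : testfun_fun theta = (fun s => a * phi s + psi s).
  by apply/funext => s; exact: E.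
apply: (cderive_lin _ _ _).2.
- exact: (testfun_smooth phi 0).
- exact: (testfun_smooth psi 0).
Qed.

Lemma distr_deriv_continuous (K : set R) : compact K ->
  exists (N : nat) (c : R), forall phi (M : R), csupp phi `<=` K ->
    (forall j t, (j <= N)%N -> `|iter j (@cderive R) phi t| <= M%:C) ->
    `|distr_deriv_fun phi| <= (c * M)%:C.
Proof.
move=> /(distribution_continuous T)[N [c H]]; exists N.+1, c => phi M sK HM.
rewrite normrN; apply: H => [|j t jN] /=.
  by apply: subset_trans sK; exact: csupp_cderive.
by rewrite -iterSr; exact: HM.
Qed.

Definition distr_deriv : distribution :=
  Distribution distr_deriv_linear distr_deriv_continuous.

End Derivative.

Section DifferentialOperator.
Variables (p : {poly R[i]}) (T : distribution).

Definition poly_ddt_fun phi : R[i] :=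
  \sum_(k < size p) p`_k * iter k distr_deriv T phi.

Lemma poly_ddt_linear (a : R[i]) phi psi theta :
  (forall t, theta t = a * phi t + psi t) ->
  poly_ddt_fun theta = a * poly_ddt_fun phi + poly_ddt_fun psi.
Proof.
move=> E; rewrite /poly_ddt_fun mulr_sumr -big_split /=.
apply: eq_bigr => k _; rewrite (distribution_linear _ E).
by rewrite mulrDr mulrCA.
Qed.

Lemma poly_ddt_continuous (K : set R) : compact K ->
  exists (N : nat) (c : R), forall phi (M : R), csupp phi `<=` K ->
    (forall j t, (j <= N)%N -> `|iter j (@cderive R) phi t| <= M%:C) ->
    `|poly_ddt_fun phi| <= (c * M)%:C.
Proof.
move=> cK; rewrite /poly_ddt_fun; elim: (size p) => [|n [N1 [c1 H1]]].
  by exists 0%N, 0 => phi M _ _; rewrite big_ord0 normr0 mul0r.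
have [N2 [c2 H2]] := distribution_continuous (iter n distr_deriv T) cK.
exists (maxn N1 N2), (c1 + Re `|p`_n| * c2) => phi M sK HM.
rewrite big_ord_recr /= mulrDl rmorphD /=.
apply: (le_trans (ler_normD _ _)); apply: lerD.
  by apply: H1 => // j t jN; apply: HM; rewrite leq_max jN.
have -> : ((Re `|p`_n| * c2 * M)%:C = `|p`_n| * (c2 * M)%:C :> R[i]).
  by rewrite -mulrA -[in RHS](RRe_real (normr_real p`_n)); exact: rmorphM.
rewrite normrM.
apply: ler_wpM2l => //; apply: H2 => // j t jN.
by apply: HM; rewrite leq_max jN orbT.
Qed.

Definition poly_ddt : distribution :=
  Distribution poly_ddt_linear poly_ddt_continuous.

End DifferentialOperator.

Section Regular.
Variables (u : R -> R[i]) (uc : continuous (u : R -> R[i]^o)).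

Definition regular_fun phi : R[i] := cintegral (fun t => u t * phi t).

Lemma testfun_continuous phi : continuous (phi : R -> R[i]^o).
Proof. by apply: cderivable_continuous; exact: (testfun_smooth phi 0). Qed.

Let ucR := (continuous_ReIm u).1 uc.

Let prod_continuous phi :
  continuous (fun t => Re (u t * phi t)) /\
  continuous (fun t => Im (u t * phi t)).
Proof.
have [u1 u2] := ucR.
have [p1 p2] := (continuous_ReIm phi).1 (@testfun_continuous phi).
split.
- under eq_fun do rewrite ReM.
  move=> t; apply: cvgB; apply: cvgM; [exact: u1|exact: p1|exact: u2|exact: p2].
- under eq_fun do rewrite ImM.
  move=> t; apply: cvgD; apply: cvgM; [exact: u1|exact: p2|exact: u2|exact: p1].
Qed.

Lemma regular_integrable phi :
  mu.-integrable [set: R] (EFin \o (fun t => Re (u t * phi t))) /\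
  mu.-integrable [set: R] (EFin \o (fun t => Im (u t * phi t))).
Proof.
have [A A0 sA] := compact_sub_itv (@testfun_compact _ phi).
have z t : ~ `[- A, A]%classic t -> u t * phi t = 0.
  by move=> nt; rewrite (@csupp_eq0 _ phi) ?mulr0// => /sA.
have [c1 c2] := prod_continuous phi.
by split; apply: (@integrable_csupp _ A) => // t /z ->.
Qed.

Lemma regular_linear (a : R[i]) phi psi theta :
  (forall t, theta t = a * phi t + psi t) ->
  regular_fun theta = a * regular_fun phi + regular_fun psi.
Proof.
move=> E; case: a E => a b E; rewrite /regular_fun /cintegral.
have [ir1 ii1] := regular_integrable phi.
have [ir2 ii2] := regular_integrable psi.
have lin3 (x y : R) (f g h : R -> R) :
    mu.-integrable [set: R] (EFin \o f) -> mu.-integrable [set: R] (EFin \o g) ->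
    mu.-integrable [set: R] (EFin \o h) ->
    \int[mu]_(t in [set: R]) (x * f t + y * g t + h t) =
    x * (\int[mu]_(t in [set: R]) f t) + y * (\int[mu]_(t in [set: R]) g t)
      + \int[mu]_(t in [set: R]) h t.
  move=> fi gi hi.
  have xf : mu.-integrable [set: R] (EFin \o (fun t => x * f t)).
    exact: (integrableZl measurableT x fi).
  have yg : mu.-integrable [set: R] (EFin \o (fun t => y * g t)).
    exact: (integrableZl measurableT y gi).
  have xy : mu.-integrable [set: R] (EFin \o (fun t => x * f t + y * g t)).
    exact: (integrableD measurableT xf yg).
  by rewrite !RintegralD// !RintegralZl.
have -> : (fun t => Re (u t * theta t)) = (fun t =>
    a * Re (u t * phi t) + - b * Im (u t * phi t) + Re (u t * psi t)).
  by apply/funext => t; rewrite E mulrDr mulrCA ReD [Re (_ * (u t * phi t))]ReM mulNr.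
have -> : (fun t => Im (u t * theta t)) = (fun t =>
    a * Im (u t * phi t) + b * Re (u t * phi t) + Im (u t * psi t)).
  by apply/funext => t; rewrite E mulrDr mulrCA ImD [Im (_ * (u t * phi t))]ImM.
rewrite !lin3//; apply/eqP.
by rewrite eq_complex !(ReD, ImD, ReM, ImM) /= mulNr !eqxx.
Qed.

Lemma regular_continuous (K : set R) : compact K ->
  exists (N : nat) (c : R), forall phi (M : R), csupp phi `<=` K ->
    (forall j t, (j <= N)%N -> `|iter j (@cderive R) phi t| <= M%:C) ->
    `|regular_fun phi| <= (c * M)%:C.
Proof.
move=> /compact_sub_itv[A A0 KA].
have [u1 u2] := ucR.
have bnd (f : R -> R) : continuous f ->
    exists2 B : R, 0 <= B & forall t, `[- A, A]%classic t -> `|f t| <= B.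
  move=> fc.
  have fI : {within `[- A, A], continuous f} by exact: continuous_subspaceT.
  have /compact_bounded[B [_ HB]] :=
    continuous_compact fI (@segment_compact _ (- A) A).
  exists (`|B| + 1); first by rewrite addr_ge0.
  move=> t tA; apply: (HB (`|B| + 1)); last by exists t.
  by rewrite (le_lt_trans (ler_norm B))// ltrDl.
have [B1 B10 HB1] := bnd _ u1; have [B2 B20 HB2] := bnd _ u2.
exists 0%N, (2 * (2 * A * (B1 + B2))) => phi M sK HM.
have z t : ~ `[- A, A]%classic t -> u t * phi t = 0.
  by move=> nt; rewrite (@csupp_eq0 _ phi) ?mulr0// => /sK/KA.
have M0 : 0 <= M.
  by rewrite -(@ler0c R); apply: le_trans (HM 0%N 0 isT).
have le t : `|u t * phi t| <= ((B1 + B2) * M)%:C.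
  have [tA|/z ->] := pselect (`[- A, A]%classic t); last first.
    by rewrite normr0 ler0c mulr_ge0// addr_ge0.
  rewrite normrM rmorphM /=; apply: ler_pM => //; last exact: (HM 0%N).
  by apply: (le_trans (normc_le_ReIm _)); rewrite lecR lerD// ?HB1 ?HB2.
have [c1 c2] := prod_continuous phi.
apply: (le_trans (normc_le_ReIm _)); rewrite lecR /=.
rewrite -!mulrA mulr_natl mulr2n !mulrA; apply: lerD.
  rewrite -mulrA; apply: Rintegral_csupp_le => // [t /z -> //|t].
  by rewrite -lecR (le_trans (normc_ge_Re _)).
rewrite -mulrA; apply: Rintegral_csupp_le => // [t /z -> //|t].
by rewrite -lecR (le_trans (normc_ge_Im _)).
Qed.

Definition regular_distribution : distribution :=
  Distribution regular_linear regular_continuous.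

End Regular.

End Distributions.

Section Concatenability.
Variable R : realType.

Definition solution_set (p : {poly R[i]}) : set (R -> R[i]) :=
  [set u | exists uc : continuous (u : R -> R[i]^o),
     forall phi : testfun R, poly_ddt p (regular_distribution uc) phi = 0].

Definition concatenation (u1 u2 : R -> R[i]) : R -> R[i] :=
  fun t => if t <= 0 then u1 t else u2 t.

Definition concatenable (S : set (R -> R[i])) : Prop :=
  forall u1 u2 : R -> R[i], S u1 -> C1 u1 -> S u2 -> C1 u2 ->
    u1 0 = u2 0 -> S (concatenation u1 u2).

End Concatenability.

(* Main.v *)
(* If deg p = 1, the C^1 solutions are classical by the fundamental lemma of the
   calculus of variations, so two of them agreeing at 0 coincide and their
   concatenation is one of them.

   If deg p >= 2, write p = (X - l)(X - m)q and take w with w(0) = 0 and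
   w' = l w + exp(m t). Then w solves the equation, while concatenating 0 with w
   gives v such that (d/dt - l)(d/dt - m)v is the Dirac mass, so that p(d/dt)v is
   q(d/dt) applied to the Dirac mass. This is nonzero: test it on t^n b(t), with
   n = deg q and b a bump function. *)
Require Import Defs.
From mathcomp Require Import all_boot all_order all_algebra.
From mathcomp Require Import complex.
From mathcomp Require Import all_classical all_reals all_analysis.
From mathcomp Require Import ring lra.
Set Implicit Arguments.
Unset Strict Implicit.
Unset Printing Implicit Defensive.
Import Order.TTheory GRing.Theory Num.Theory.
Import numFieldNormedType.Exports.
Import Defs.
Local Notation Re := complex.Re.
Local Notation Im := complex.Im.
Local Open Scope complex_scope.
Local Open Scope classical_set_scope.
Local Open Scope ring_scope.

(** * Derivatives of complex-valued functions, exponentials and linear equations *)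

Section ComplexDerivative.
Variable R : realType.
Implicit Types (u v : R -> R[i]) (t : R) (z d : R[i]).

Lemma complexP z d : Re z = Re d -> Im z = Im d -> z = d.
Proof. by case: z d => [? ?] [? ?] /= -> ->. Qed.

(** Derivability and value travel together, so the rules for sums and products chain without
    separate derivability conditions. *)
Definition is_cderive u t d : Prop :=
  is_derive t (1 : R) (fun s => Re (u s)) (Re d) /\
  is_derive t (1 : R) (fun s => Im (u s)) (Im d).

Lemma is_cderiveP u t d : is_cderive u t d <-> cderivable u t /\ cderive u t = d.
Proof.
split.
  move=> [[rd rE] [id iE]]; split; first by split.
  by apply: complexP; rewrite /cderive/= derive1E.
move=> [[rd id] <-]; split; rewrite /= derive1E; exact: DeriveDef.
Qed.

Lemma cderivableP u t : cderivable u t -> is_cderive u t (cderive u t).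
Proof. by move=> ud; apply/is_cderiveP. Qed.

Lemma is_cderive_eq u t d d' : is_cderive u t d -> d = d' -> is_cderive u t d'.
Proof. by move=> + <-. Qed.

Lemma is_cderive_cst z t : is_cderive (fun=> z) t 0.
Proof. by split; exact: is_derive_cst. Qed.

Lemma is_cderive_real (f : R -> R) t (d : R) :
  is_derive t (1 : R) f d -> is_cderive (fun s => (f s)%:C) t d%:C.
Proof. by split=> //=; exact: is_derive_cst. Qed.

Lemma is_cderiveD u v t d e :
  is_cderive u t d -> is_cderive v t e -> is_cderive (fun s => u s + v s) t (d + e).
Proof.
move=> [ur ui] [vr vi]; split; rewrite (ReD, ImD).
- rewrite (_ : (fun s => _) = (fun s => Re (u s)) + (fun s => Re (v s))).
    exact: is_deriveD.
  by apply/funext => s; rewrite ReD.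
- rewrite (_ : (fun s => _) = (fun s => Im (u s)) + (fun s => Im (v s))).
    exact: is_deriveD.
  by apply/funext => s; rewrite ImD.
Qed.

Lemma is_cderiveM u v t d e : is_cderive u t d -> is_cderive v t e ->
  is_cderive (fun s => u s * v s) t (d * v t + u t * e).
Proof.
move=> [ur ui] [vr vi]; split.
- rewrite (_ : (fun s => _) = (fun s => Re (u s)) * (fun s => Re (v s)) -
    (fun s => Im (u s)) * (fun s => Im (v s))).
    have := is_deriveB (is_deriveM ur vr) (is_deriveM ui vi).
    by move=> /is_derive_eq; apply; rewrite ReD !ReM /GRing.scale /=; ring.
  by apply/funext => s; rewrite ReM.
- rewrite (_ : (fun s => _) = (fun s => Re (u s)) * (fun s => Im (v s)) +
    (fun s => Im (u s)) * (fun s => Re (v s))).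
    have := is_deriveD (is_deriveM ur vi) (is_deriveM ui vr).
    by move=> /is_derive_eq; apply; rewrite ImD !ImM /GRing.scale /=; ring.
  by apply/funext => s; rewrite ImM.
Qed.

Lemma is_cderiveZ z u t d :
  is_cderive u t d -> is_cderive (fun s => z * u s) t (z * d).
Proof.
move=> ud; apply: (is_cderive_eq (is_cderiveM (is_cderive_cst z t) ud)).
by rewrite mul0r add0r.
Qed.

Lemma is_cderiveN u t d : is_cderive u t d -> is_cderive (fun s => - u s) t (- d).
Proof.
move=> /(is_cderiveZ (-1)); rewrite mulN1r.
by under eq_fun do rewrite mulN1r.
Qed.

Lemma is_cderive_continuous u (u' : R -> R[i]) :
  (forall t, is_cderive u t (u' t)) -> continuous (u : R -> R[i]^o).
Proof.
by move=> ud; apply: cderivable_continuous => t; have /is_cderiveP[] := ud t.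
Qed.

Lemma cderive_eq u (u' : R -> R[i]) :
  (forall t, is_cderive u t (u' t)) -> cderive u = u'.
Proof. by move=> ud; apply/funext => t; have /is_cderiveP[] := ud t. Qed.

Lemma is_cderive0_cst u s t : (forall x, is_cderive u x 0) -> u s = u t.
Proof.
move=> ud; apply: complexP.
- by apply: (@is_derive_0_is_cst _ (fun s => Re (u s))) => x; have [] := ud x.
- by apply: (@is_derive_0_is_cst _ (fun s => Im (u s))) => x; have [] := ud x.
Qed.

Lemma continuous_cadd u v : continuous (u : R -> R[i]^o) ->
  continuous (v : R -> R[i]^o) -> continuous ((fun s => u s + v s) : R -> R[i]^o).
Proof. by move=> uc vc t; apply: cvgD; [exact: uc|exact: vc]. Qed.

Lemma continuous_cmul u v : continuous (u : R -> R[i]^o) ->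
  continuous (v : R -> R[i]^o) -> continuous ((fun s => u s * v s) : R -> R[i]^o).
Proof. by move=> uc vc t; apply: cvgM; [exact: uc|exact: vc]. Qed.

Lemma continuous_ccst z : continuous ((fun=> z) : R -> R[i]^o).
Proof. exact: is_cderive_continuous (is_cderive_cst z). Qed.

(** The exponential of $zt$ in Euler's form, which reduces its derivative to those of real
    functions. *)
Definition cexp z : R -> R[i] := fun t =>
  (expR (Re z * t))%:C * (cos (Im z * t) +i* sin (Im z * t)).

Lemma is_cderive_cexp z t : is_cderive (cexp z) t (z * cexp z t).
Proof.
have lin (x : R) : is_derive t (1 : R) (fun s => x * s) x.
  have := is_deriveZ x (is_derive_id t (1 : R)).
  by move=> /is_derive_eq; apply; rewrite /GRing.scale /= mulr1.
have ed : is_cderive (fun s => (expR (Re z * s))%:C) t (expR (Re z * t) * Re z)%:C.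
  by apply: is_cderive_real; apply: is_derive1_comp.
have td : is_cderive (fun s => cos (Im z * s) +i* sin (Im z * s)) t
    ((- sin (Im z * t) * Im z) +i* (cos (Im z * t) * Im z)).
  by split=> /=; apply: is_derive1_comp.
apply: (is_cderive_eq (is_cderiveM ed td)).
by apply: complexP; rewrite !(ReD,ImD,ReM,ImM)/=; ring.
Qed.

Lemma cexp0 z : cexp z 0 = 1.
Proof. by rewrite /cexp !mulr0 expR0 cos0 sin0 mul1r. Qed.

Lemma cexp_neq0 z t : cexp z t != 0.
Proof.
rewrite /cexp mulf_neq0//.
  by rewrite (inj_eq (@complexI _)) expR_eq0.
rewrite eq_complex /=; apply/negP => /andP[/eqP c0 /eqP s0].
have := cos2Dsin2 (Im z * t); rewrite c0 s0 expr0n addr0 => /eqP.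
by rewrite eq_sym oner_eq0.
Qed.

(** Integrating factor: [cexp (- z)] times [u] has zero derivative, and the exponential never
    vanishes. *)
Lemma linear_ode_eq0 z u : (forall t, is_cderive u t (z * u t)) -> u 0 = 0 ->
  forall t, u t = 0.
Proof.
move=> ud u0 t.
have E : cexp (- z) t * u t = cexp (- z) 0 * u 0.
  apply: (@is_cderive0_cst (fun s => cexp (- z) s * u s)) => x.
  apply: (is_cderive_eq (is_cderiveM (is_cderive_cexp _ _) (ud x))); ring.
have /eqP := E; rewrite u0 mulr0 mulf_eq0 (negbTE (cexp_neq0 _ _)) /=.
by move/eqP.
Qed.

(** Such a [w] is annihilated by $(d/dt-z)(d/dt-d)$ and has $w'(0)=1$, hence a unit jump of the
    derivative when glued to 0. The witness is $te^{zt}$ for a double root, and otherwise the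
    divided difference of the two exponentials. *)
Lemma second_order_solution z d : exists w : R -> R[i],
  w 0 = 0 /\ forall t, is_cderive w t (z * w t + cexp d t).
Proof.
have [->|zd] := eqVneq d z.
  exists (fun t => t%:C * cexp z t); split; first by rewrite mul0r.
  move=> t; have idd : is_cderive (fun s => s%:C) t 1.
    exact: (is_cderive_real (is_derive_id t (1 : R))).
  apply: (is_cderive_eq (is_cderiveM idd (is_cderive_cexp z t))); ring.
exists (fun t => (d - z)^-1 * (cexp d t + - cexp z t)); split.
  by rewrite !cexp0 subrr mulr0.
move=> t; apply: (is_cderive_eq (is_cderiveZ _
  (is_cderiveD (is_cderive_cexp d t) (is_cderiveN (is_cderive_cexp z t))))).
by have : d - z != 0 by [rewrite subr_eq0]; move=> dz; field.
Qed.

End ComplexDerivative.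

(** * Integrals of compactly supported derivatives *)

Section CompactlySupportedPrimitive.
Variable R : realType.
Local Notation mu := (@lebesgue_measure R).

Lemma Rintegral_derive (F f : R -> R) (a b : R) : a < b ->
  (forall t, is_derive t (1 : R) F (f t)) -> continuous f ->
  \int[mu]_(t in `[a, b]) f t = F b - F a.
Proof.
move=> ab Fd fc; rewrite /Rintegral (@continuous_FTC2 _ f F)//.
- exact: continuous_subspaceT.
- have Fc : continuous F.
    by move=> t; apply/differentiable_continuous/derivable1_diffP; case: (Fd t).
  split.
  + by move=> t _; case: (Fd t).
  + exact/cvg_at_right_filter/Fc.
  + exact/cvg_at_left_filter/Fc.
- by move=> t _; rewrite derive1E; case: (Fd t).
Qed.

(** Fundamental theorem of calculus on a segment at whose outer ends [F] vanishes; on the half-line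
    the boundary term at 0 survives. *)
Lemma Rintegral_derive_csupp (F f : R -> R) (A : R) :
  (forall t, is_derive t (1 : R) F (f t)) -> continuous f ->
  (forall t, A < `|t| -> F t = 0 /\ f t = 0) ->
  \int[mu]_(t in [set: R]) f t = 0 /\
  \int[mu]_(t in [set: R]) (if t <= 0 then 0 else f t) = - F 0.
Proof.
(* [A] may be negative, so [B] is taken both positive and above [A]. *)
move=> Fd fc z; pose B := `|A| + 1.
have B0 : 0 < B by rewrite ltr_wpDl.
have AB : A < B by rewrite (le_lt_trans (ler_norm _))// ltrDl.
have FB : F B = 0 by apply: (z _ _).1; rewrite gtr0_norm.
have FNB : F (- B) = 0 by apply: (z _ _).1; rewrite normrN gtr0_norm.
split.
  rewrite (_ : f = f \_ `[- B, B]) -?Rintegral_mkcond.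
    by rewrite (Rintegral_derive _ Fd) ?FB ?FNB ?subrr// gtrN.
  apply/funext => t; rewrite patchE; case: ifPn => //.
  rewrite notin_setE /= in_itv /= -ler_norml => /negP; rewrite -ltNge => Bt.
  by rewrite (z t _).2// (lt_trans AB).
rewrite (_ : (fun t => _) = f \_ `]0, B]) -?Rintegral_mkcond.
  rewrite Rintegral_itv_obnd_cbnd; last first.
    apply: (@integrableS _ _ _ mu `[0, B]) => //.
      by apply: subset_itvr; rewrite bnd_simp.
    apply: continuous_compact_integrable; first exact: segment_compact.
    exact: continuous_subspaceT.
  by rewrite (Rintegral_derive _ Fd)// FB sub0r.
apply/funext => t; rewrite patchE mem_setE in_itv /= ltNge; case: leP => //= t0.
by case: leP => // Bt; rewrite (z t _).2// (lt_trans AB)// gtr0_norm.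
Qed.

(** The first integral removes total derivatives from weak equations; the boundary term of the
    second is the source of the Dirac mass. *)
Lemma cintegral_derive_csupp (G g : R -> R[i]) : compact (csupp G) ->
  (forall t, is_cderive G t (g t)) -> continuous (g : R -> R[i]^o) ->
  cintegral g = 0 /\ cintegral (fun t => if t <= 0 then 0 else g t) = - G 0.
Proof.
move=> /compact_sub_itv[A _ GA] Gd /continuous_ReIm[gr gi].
have z t : A < `|t| -> G t = 0 /\ g t = 0.
  move=> At; have nt : ~ csupp G t.
    by move=> /GA /=; rewrite in_itv /= -ler_norml leNgt At.
  split; first exact: csupp_eq0.
  rewrite -(cderive_eq Gd); apply: csupp_eq0 => /csupp_cderive; exact: nt.
have [|r1 r2] := Rintegral_derive_csupp (fun t => (Gd t).1) gr (A := A).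
  by move=> t /z[-> ->].
have [|i1 i2] := Rintegral_derive_csupp (fun t => (Gd t).2) gi (A := A).
  by move=> t /z[-> ->].
split; rewrite /cintegral; first by rewrite r1 i1.
under eq_Rintegral do rewrite (fun_if (@Re R)) /=.
rewrite r2; under eq_Rintegral do rewrite (fun_if (@Im R)) /=.
by rewrite i2; case: (G 0).
Qed.

Lemma csuppMr (u v : R -> R[i]) : csupp (fun t => u t * v t) `<=` csupp v.
Proof.
apply: closureS => t /=; apply: contraNneq => ->; by rewrite mulr0.
Qed.

Lemma csuppD (u v : R -> R[i]) :
  csupp (fun t => u t + v t) `<=` csupp u `|` csupp v.
Proof.
rewrite /csupp -closureU; apply: closureS => t /= uv.
have [u0|u0] := eqVneq (u t) 0; last by left.
by right; move: uv; rewrite u0 add0r.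
Qed.

Lemma compact_csupp_sub (u : R -> R[i]) (K : set R) :
  compact K -> csupp u `<=` K -> compact (csupp u).
Proof. by move=> cK; apply: subclosed_compact cK; exact: closed_closure. Qed.

Lemma csupp_sub_closed (u : R -> R[i]) (K : set R) : closed K ->
  (forall t, ~ K t -> u t = 0) -> csupp u `<=` K.
Proof.
move=> cK uK; rewrite [X in _ `<=` X](closure_id _).1//; apply: closureS => t /=.
by move=> /eqP ut; apply: contrapT => /uK.
Qed.

End CompactlySupportedPrimitive.

(** * A function that is flat at the origin *)

Section FlatFunction.
Variable R : realType.
Implicit Types (P : {poly R}) (x y : R).

(** A single term of the exponential series gives $y^i\le i!\,e^y$; sum over the monomials. *)
Lemma horner_le_expR P : exists C : R, forall y, 0 <= y -> `|P.[y]| <= C * expR y.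
Proof.
have powle i y : 0 <= y -> y ^+ i <= i`!%:R * expR y.
  case: i => [|i] y0; first by rewrite expr0 fact0 mul1r -expR0 ler_expR.
  rewrite mulrC -ler_pdivrMr ?ltr0n ?fact_gt0//.
  by apply: le_trans (expR_ge1Dxn i y0); rewrite lerDr.
exists (\sum_(i < size P) `|P`_i| * i`!%:R) => y y0.
rewrite horner_coef mulr_suml; apply: (le_trans (ler_norm_sum _ _ _)).
apply: ler_sum => i _; rewrite normrM -mulrA ler_wpM2l// ger0_norm ?exprn_ge0//.
exact: powle.
Qed.

(* [exp(-1/x)] times a polynomial in [1/x], extended by [0]: a family stable
   under differentiation. *)
Definition flat P x : R := if 0 < x then P.[x^-1] * expR (- x^-1) else 0.

Lemma flat_bounded P : exists C : R, forall x, `|flat P x| <= C.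
Proof.
have [C HC] := horner_le_expR P; exists C => x.
have C0 : 0 <= C by have := HC 0 (lexx _); rewrite expR0 mulr1; apply: le_trans.
rewrite /flat; case: ifPn => x0; last by rewrite normr0.
rewrite normrM (ger0_norm (expR_ge0 _)) expRN ler_pdivrMr ?expR_gt0//.
by apply: HC; rewrite invr_ge0 ltW.
Qed.

(** The bounded cofactor [flat ('X * P)] forces continuity at 0 and is the difference quotient of
    [flat P] there. *)
Lemma flatXM P x : flat P x = flat ('X * P) x * x.
Proof.
rewrite /flat; case: ifPn => x0; last by rewrite mul0r.
by rewrite hornerM hornerX; field; rewrite gt_eqF.
Qed.

Lemma flat_le0 P x : x <= 0 -> flat P x = 0.
Proof. by rewrite /flat ltNge => ->. Qed.

Lemma flat_continuous0 P : {for 0, continuous (flat P)}.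
Proof.
have [C HC] := flat_bounded ('X * P).
apply/cvgrPdist_le => e e0.
have d0 : 0 < (`|C| + 1)^-1 * e by rewrite mulr_gt0// invr_gt0 ltr_wpDl.
near=> x.
rewrite flat_le0// sub0r normrN flatXM normrM.
apply: (@le_trans _ _ ((`|C| + 1) * `|x|)).
  rewrite ler_wpM2r// (le_trans (HC _))// (le_trans (ler_norm _))// lerDl//.
rewrite -ler_pdivlMl; last by rewrite ltr_wpDl.
near: x; exact: (@nbhs0_le _ R^o _ d0).
Unshelve. all: by end_near. Qed.

(** To the right of 0, each chain rule through $1/x$ produces a factor $x^{-2}$, hence the
    ['X ^+ 2]. To the left the function is locally 0, and at 0 Caratheodory's criterion applies with
    slope [flat ('X * P)]. *)
Lemma is_derive_flat P x :
  is_derive x (1 : R) (flat P) (flat ('X ^+ 2 * (P - P^`())) x).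
Proof.
have [x0|x0|->] := ltgtP x 0.
- rewrite [X in is_derive _ _ _ X]flat_le0 ?ltW//.
  apply: (@near_eq_is_derive _ _ _ (cst 0)).
  by apply: filterS (lt_nbhsl x0) => y /ltW/flat_le0 ->.
- apply: (@near_eq_is_derive _ _ _ (fun y => P.[y^-1] * expR (- y^-1))).
    by apply: filterS (lt_nbhsr x0) => y y0; rewrite /flat y0.
  have dV : is_derive x (1 : R) (fun y => y^-1) (- (x ^- 2)).
    have xn0 : x != 0 by rewrite gt_eqF.
    have := @is_deriveV _ id x 1 1 xn0 (is_derive_id x (1 : R)).
    by move=> /is_derive_eq; apply; rewrite /GRing.scale /= mulr1.
  have dP : is_derive x (1 : R) (fun y => P.[y^-1]) (P^`().[x^-1] * - (x ^- 2)).
    exact: (@is_derive1_comp _ (horner P) (fun y => y^-1)).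
  have dN : is_derive x (1 : R) (fun y => - y^-1) (x ^- 2).
    by have := is_deriveN dV; rewrite opprK.
  have dE : is_derive x (1 : R) (fun y => expR (- y^-1)) (expR (- x^-1) * x ^- 2).
    exact: (@is_derive1_comp _ expR (fun y => - y^-1)).
  have := is_deriveM dP dE; move=> /is_derive_eq; apply.
  rewrite /flat x0 /GRing.scale /= !hornerE /= exprVn; ring.
- rewrite [X in is_derive _ _ _ X]flat_le0//.
  apply/is_derive1_caratheodory; exists (flat ('X * P)); split.
  + by move=> z; rewrite (flat_le0 P (lexx 0)) !subr0 -flatXM.
  + exact: flat_continuous0.
  + by rewrite flat_le0.
Qed.

End FlatFunction.

(** * Smoothness through finite orders *)

Section Smooth.
Variable R : realType.
Implicit Types (u v : R -> R[i]).

(** Smoothness cut at a finite order: the product rule then closes it under products by induction on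
    [n], with no formula for iterated derivatives of a product. *)
Fixpoint smooth_upto n u : Prop :=
  (forall t, cderivable u t) /\
  if n is n'.+1 then smooth_upto n' (cderive u) else True.

Lemma smooth_upto_cderivable n u t : smooth_upto n u -> cderivable u t.
Proof. by case: n => [[]|n []]. Qed.

Lemma CinftyP u : Cinfty u <-> forall n, smooth_upto n u.
Proof.
split=> [us n|us n t].
  elim: n u us => [|n IH] u us; split=> //; try exact: (us 0%N).
  by apply: IH => k t; rewrite -iterSr; exact: us.
elim: n u {us}(us n) => [|n IH] u [] // _ /IH.
by rewrite iterSr.
Qed.

Lemma smooth_uptoW n u : smooth_upto n.+1 u -> smooth_upto n u.
Proof.
elim: n u => [|n IH] u [ud us]; first by split.
by split=> //; exact: IH.
Qed.

Lemma smooth_upto_cst n (z : R[i]) : smooth_upto n (fun=> z).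
Proof.
elim: n z => [|n IH] z /=.
  by split=> // t; have /is_cderiveP[] := is_cderive_cst z t.
split=> [t|]; first by have /is_cderiveP[] := is_cderive_cst z t.
by rewrite (cderive_eq (is_cderive_cst z)).
Qed.

Lemma smooth_uptoD n u v : smooth_upto n u -> smooth_upto n v ->
  smooth_upto n (fun t => u t + v t).
Proof.
elim: n u v => [|n IH] u v uS vS.
all: have ud t := is_cderiveD (cderivableP (smooth_upto_cderivable t uS))
       (cderivableP (smooth_upto_cderivable t vS)).
all: split=> [t|//]; first by have /is_cderiveP[] := ud t.
by rewrite (cderive_eq ud); apply: IH; [case: uS|case: vS].
Qed.

Lemma smooth_uptoM n u v : smooth_upto n u -> smooth_upto n v ->
  smooth_upto n (fun t => u t * v t).
Proof.
elim: n u v => [|n IH] u v uS vS.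
all: have ud t := is_cderiveM (cderivableP (smooth_upto_cderivable t uS))
       (cderivableP (smooth_upto_cderivable t vS)).
all: split=> [t|//]; first by have /is_cderiveP[] := ud t.
rewrite (cderive_eq ud); apply: smooth_uptoD; apply: IH.
- by case: uS.
- exact: smooth_uptoW.
- exact: smooth_uptoW.
- by case: vS.
Qed.

(** The affine argument, with [s] equal to 1 or -1, provides the two ends of a bump; the derivative
    stays in the family up to the factor [s]. *)
Lemma smooth_upto_flat n (P : {poly R}) (s a : R) :
  smooth_upto n (fun t => (flat P (s * (t - a)))%:C).
Proof.
have fd Q t : is_cderive (fun t => (flat Q (s * (t - a)))%:C) t
    (s%:C * (flat ('X ^+ 2 * (Q - Q^`())) (s * (t - a)))%:C).
  have ld : is_derive t (1 : R) (fun t => s * (t - a)) s.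
    have := is_deriveZ s (is_deriveB (is_derive_id t (1 : R)) (is_derive_cst a t 1)).
    move=> /is_derive_eq; apply; rewrite subr0; exact: mulr1.
  rewrite -(rmorphM (real_complex R)) mulrC; apply: is_cderive_real.
  exact: (@is_derive1_comp _ (flat Q) _ t _ _ (is_derive_flat Q _) ld).
elim: n P => [|n IH] P; (split=> [t|//]; first by have /is_cderiveP[] := fd P t).
by rewrite (cderive_eq (fd P)); apply: smooth_uptoM; [exact: smooth_upto_cst|].
Qed.

Lemma CinftyD u v : Cinfty u -> Cinfty v -> Cinfty (fun t => u t + v t).
Proof. by move=> /CinftyP us /CinftyP vs; apply/CinftyP => n; exact: smooth_uptoD. Qed.

Lemma CinftyM u v : Cinfty u -> Cinfty v -> Cinfty (fun t => u t * v t).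
Proof. by move=> /CinftyP us /CinftyP vs; apply/CinftyP => n; exact: smooth_uptoM. Qed.

Lemma Cinfty_cst (z : R[i]) : Cinfty (fun=> z : R[i]).
Proof. by apply/CinftyP => n; exact: smooth_upto_cst. Qed.

Lemma is_cderive_id (t : R) : is_cderive (fun s : R => s%:C) t 1.
Proof. exact: (is_cderive_real (is_derive_id t (1 : R))). Qed.

Lemma Cinfty_id : Cinfty (fun t : R => t%:C).
Proof.
apply/CinftyP => n; case: n => [|n];
  (split=> [t|//]; first by have /is_cderiveP[] := is_cderive_id t).
by rewrite (cderive_eq is_cderive_id); exact: smooth_upto_cst.
Qed.

End Smooth.

(** * Construction of test functions *)

Section TestFunctions.
Variable R : realType.
Implicit Types (phi psi : testfun R) (u : R -> R[i]).

Lemma testfun_is_cderive phi t : is_cderive phi t (testfun_deriv phi t).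
Proof. exact/cderivableP/(testfun_smooth phi 0). Qed.

(** Product of two flat functions, one vanishing to the left of [a], the other to the right of
    [b]. *)
Lemma testfun_bump (a b : R) : exists (f : R -> R) (phi : testfun R),
  [/\ forall t, a < t < b -> 0 < f t, forall t, ~~ (a < t < b) -> f t = 0 &
      forall t, phi t = (f t)%:C].
Proof.
pose f t := flat 1 (1 * (t - a)) * flat 1 (- 1 * (t - b)).
have f0 t : ~~ (a < t < b) -> f t = 0.
  rewrite negb_and -!leNgt => /orP[h|h]; rewrite /f.
    by rewrite (@flat_le0 _ _ (1 * _)) ?mul0r// mul1r subr_le0.
  by rewrite (@flat_le0 _ _ (- 1 * _)) ?mulr0// mulN1r opprB subr_le0.
have fs : Cinfty (fun t => (f t)%:C).
  apply/CinftyP => n; under eq_fun do rewrite rmorphM.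
  by apply: smooth_uptoM; exact: smooth_upto_flat.
have fc : compact (csupp (fun t => (f t)%:C)).
  apply: (@compact_csupp_sub _ _ `[a, b]); first exact: segment_compact.
  apply: csupp_sub_closed; first exact: itv_closed.
  move=> t /= /negP; rewrite in_itv /= => tab; rewrite f0//.
  by apply: contra tab => /andP[h1 h2]; rewrite !ltW.
exists f, (TestFun fs fc); split=> // t /andP[at_ tb].
rewrite /f /flat mul1r mulN1r opprB !subr_gt0 at_ tb !(hornerC 1).
by rewrite !mulr_gt0 ?expR_gt0.
Qed.

Lemma testfun_mul u phi : Cinfty u ->
  exists psi, forall t, psi t = u t * phi t.
Proof.
move=> us; have ps := CinftyM us (@testfun_smooth _ phi).
have pc := compact_csupp_sub (@testfun_compact _ phi) (@csuppMr _ u phi).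
by exists (TestFun ps pc).
Qed.

Lemma testfun_add phi psi : exists theta : testfun R, forall t, theta t = phi t + psi t.
Proof.
have ps := CinftyD (@testfun_smooth _ phi) (@testfun_smooth _ psi).
have pc := compact_csupp_sub
  (compactU (@testfun_compact _ phi) (@testfun_compact _ psi)) (@csuppD _ phi psi).
by exists (TestFun ps pc).
Qed.

(** The equality of values is the premise that [distribution_linear] asks for. *)
Lemma testfun_lin (z : R[i]) phi psi :
  exists theta : testfun R, forall t, theta t = z * phi t + psi t.
Proof.
have [zphi zE] := testfun_mul phi (Cinfty_cst z).
have [theta thE] := testfun_add zphi psi.
by exists theta => t; rewrite thE zE.
Qed.

End TestFunctions.

(** * The fundamental lemma of the calculus of variations *)

Section FundamentalLemma.
Variable R : realType.
Local Notation mu := (@lebesgue_measure R).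
Implicit Types (phi psi : testfun R) (u g : R -> R[i]).

(** By continuity [k] exceeds half of [k t0] on a segment of positive length around [t0]. *)
Lemma Rintegral_continuous_gt0 (k : R -> R) (t0 : R) : continuous k ->
  mu.-integrable [set: R] (EFin \o k) -> (forall t, 0 <= k t) -> 0 < k t0 ->
  0 < \int[mu]_(t in [set: R]) k t.
Proof.
move=> kc ki k0 kt0; have c0 : 0 < k t0 / 2 by rewrite divr_gt0.
have /cvgrPdist_lt/(_ _ c0) := kc t0 => /nbhs_normP.
move=> [d /= d0 Hd]; pose I := `[t0 - d / 2, t0 + d / 2]%classic.
have mI : measurable (I : set (measurableTypeR R)) by exact: measurable_itv.
have kI : mu.-integrable I (EFin \o k) by exact: (integrableS _ _ _ ki).
have cI : mu.-integrable I (EFin \o cst (k t0 / 2)).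
  apply: continuous_compact_integrable; first exact: segment_compact.
  by apply: continuous_subspaceT => t; exact: cst_continuous.
apply: (@lt_le_trans _ _ (\int[mu]_(t in I) cst (k t0 / 2) t)).
  rewrite Rintegral_cst// mulr_gt0// [X in fine X](_ : _ = d%:E)//.
  apply: etrans (lebesgue_measure_itv `[t0 - d / 2, t0 + d / 2]) _.
  rewrite /= lte_fin ifT; last lra.
  by rewrite -EFinB; congr EFin; field.
apply: (@le_trans _ _ (\int[mu]_(t in I) k t)).
  apply: le_Rintegral => // t; rewrite /I /= in_itv /= => /andP[t1 t2].
  have /Hd/= : `|t0 - t| < d by rewrite ltr_norml; apply/andP; split; lra.
  rewrite ltr_norml => /andP[_ ?]; lra.
rewrite Rintegral_mkcond; apply: le_Rintegral => //.
  by rewrite -restrict_EFin; apply/(integrable_mkcond _ mI).1.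
by move=> t _; rewrite patchE; case: ifP.
Qed.

(** Where the real part is positive, a bump supported nearby would give a positive integral.
    Rotating [g] by constants turns this one-sided bound into the vanishing of both parts. *)
Lemma fundamental_lemma g : continuous (g : R -> R[i]^o) ->
  (forall phi, cintegral (fun t => g t * phi t) = 0) -> forall t, g t = 0.
Proof.
have Re_le0 h : continuous (h : R -> R[i]^o) ->
    (forall phi, cintegral (fun t => h t * phi t) = 0) -> forall t, Re (h t) <= 0.
  move=> hc h0 t; rewrite leNgt; apply/negP => ht.
  have [rc _] := (continuous_ReIm h).1 hc.
  have /cvgrPdist_lt/(_ _ ht) := rc t => /nbhs_normP.
  move=> [d /= d0 Hd].
  have [f [phi [fpos f0 phiE]]] := testfun_bump (t - d) (t + d).
  have prodE s : Re (h s * phi s) = Re (h s) * f s.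
    by rewrite ReM phiE /= mulr0 subr0.
  have : 0 < \int[mu]_(t in [set: R]) Re (h t * phi t).
    apply: (@Rintegral_continuous_gt0 _ t).
    - have hphic := continuous_cmul hc (@testfun_continuous _ phi).
      by have [] := (continuous_ReIm _).1 hphic.
    - by have [] := regular_integrable hc phi.
    - move=> s; rewrite prodE; have [sd|/f0 ->] := boolP (t - d < s < t + d).
        have fs := fpos _ sd; move: sd => /andP[s1 s2].
        have /Hd/= : `|t - s| < d by rewrite ltr_norml; apply/andP; split; lra.
        rewrite ltr_norml => /andP[_ ?]; rewrite mulr_ge0 ?ltW//; lra.
      by rewrite mulr0.
    - by rewrite prodE mulr_gt0// fpos//; apply/andP; split; lra.
  have /(congr1 (@Re R)) := h0 phi; rewrite /cintegral /= => ->.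
  by rewrite ltxx.
move=> gc g0 t.
(* The values 1 and -1 of [z] squeeze the real part of [g t], the values $i$ and $-i$ its imaginary
   part. *)
have zg z : Re (z * g t) <= 0.
  apply: (Re_le0 (fun s => z * g s)).
    by apply: continuous_cmul; [exact: continuous_ccst|exact: gc].
  move=> phi; have [zphi zE] := testfun_mul phi (Cinfty_cst z).
  rewrite -[RHS](g0 zphi); congr cintegral; apply/funext => s.
  by rewrite zE; ring.
apply: complexP => /=; apply/eqP; rewrite eq_le.
  by have := zg 1; have := zg (-1); rewrite mulN1r mul1r; case: (g t) => a b /=; lra.
have := zg 'i; have := zg (- 'i); rewrite !ReM /=; case: (g t) => a b /=; lra.
Qed.

Lemma cintegrable_csupp g : continuous (g : R -> R[i]^o) -> compact (csupp g) ->
  mu.-integrable [set: R] (EFin \o (fun t => Re (g t))) /\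
  mu.-integrable [set: R] (EFin \o (fun t => Im (g t))).
Proof.
move=> /continuous_ReIm[gr gi] /compact_sub_itv[A A0 gA].
have z t : ~ `[- A, A]%classic t -> g t = 0 by move=> nt; apply/csupp_eq0 => /gA.
by split; apply: (@integrable_csupp _ A) => // t /z ->.
Qed.

Lemma cintegralD u g : continuous (u : R -> R[i]^o) -> compact (csupp u) ->
  continuous (g : R -> R[i]^o) -> compact (csupp g) ->
  cintegral (fun t => u t + g t) = cintegral u + cintegral g.
Proof.
move=> uc us gc gs; have [ur ui] := cintegrable_csupp uc us.
have [gr gi] := cintegrable_csupp gc gs.
apply: complexP; rewrite (ReD, ImD) /cintegral /= -RintegralD//;
  by apply: eq_Rintegral => t _; rewrite (ReD, ImD).
Qed.

End FundamentalLemma.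

(** * Polynomials acting on sequences *)

Section CoefficientFunctional.
Variable F : idomainType.
Implicit Types (p q : {poly F}) (c : nat -> F).

(** The linear functional sending $X^k$ to [c k]. When [c k] is the [k]-th derivative of a
    distribution at a test function, it evaluates $p(d/dt)$. *)
Definition coeff_sum p c := \sum_(k < size p) p`_k * c k.

Lemma coeff_sum_widen n p c : (size p <= n)%N ->
  coeff_sum p c = \sum_(k < n) p`_k * c k.
Proof.
move=> pn; rewrite /coeff_sum (big_ord_widen n (fun k => p`_k * c k) pn).
rewrite big_mkcond; apply: eq_bigr => k _; case: ltnP => // kp.
by rewrite nth_default ?mul0r.
Qed.

(** Multiplication by ['X] shifts the sequence, so linear factors of a differential operator can be
    peeled off one at a time. *)
Lemma coeff_sum_XsubC q (l : F) c :
  coeff_sum (('X - l%:P) * q) c = coeff_sum q (fun k => c k.+1 - l * c k).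
Proof.
have sq : (size (('X - l%:P) * q)%R <= (size q).+1)%N.
  by apply: (leq_trans (size_polyMleq _ _)); rewrite size_XsubC.
rewrite (coeff_sum_widen _ sq).
under eq_bigr do rewrite mulrBl coefB coefXM coefCM mulrBl.
(* The shifted sum loses its term at index 0, the other its term at [size q], where the coefficient
   of [q] is 0 by default; both then have [size q] terms. *)
rewrite sumrB big_ord_recl /= mul0r add0r [X in _ - X]big_ord_recr /=.
rewrite [q`_(size q)]nth_default// mulr0 mul0r addr0 -sumrB.
by apply: eq_bigr => k _ /=; ring.
Qed.

Lemma eq_coeff_sum p c d : c =1 d -> coeff_sum p c = coeff_sum p d.
Proof. by move=> cd; apply: eq_bigr => k _; rewrite cd. Qed.

Lemma coeff_sum0 p c : (forall k, c k = 0) -> coeff_sum p c = 0.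
Proof. by move=> c0; apply: big1 => k _; rewrite c0 mulr0. Qed.

End CoefficientFunctional.

(** * Weak equations and the Dirac mass *)

Section DistributionalEquation.
Variable R : realType.
Implicit Types (phi psi : testfun R) (T : distribution R) (p q : {poly R[i]}).
Local Notation D := (@testfun_deriv R).

Lemma iter_distr_deriv k T phi :
  iter k (@distr_deriv R) T phi = (-1) ^+ k * T (iter k D phi).
Proof.
elim: k phi => [|k IH] phi; first by rewrite mul1r.
rewrite -[LHS]/(- iter k (@distr_deriv R) T (D phi)) IH -iterSr.
by rewrite exprS mulN1r mulNr.
Qed.

Lemma poly_ddtE p T phi :
  poly_ddt p T phi = coeff_sum p (fun k => (-1) ^+ k * T (iter k D phi)).
Proof. by apply: eq_bigr => k _; rewrite iter_distr_deriv. Qed.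

(** [psi] is $(d/dt+l)(d/dt+m)$ applied to [phi], the formal adjoint of $(d/dt-l)(d/dt-m)$. *)
Lemma testfun_quadratic (l m : R[i]) phi : exists psi,
  (forall t, psi t = D (D phi) t + (l + m) * D phi t + l * m * phi t) /\
  forall T, T psi = T (D (D phi)) + (l + m) * T (D phi) + l * m * T phi.
Proof.
have [chi chiE] := testfun_lin (l + m) (D phi) (D (D phi)).
have [psi psiE] := testfun_lin (l * m) phi chi.
exists psi; split=> [t|T]; first by rewrite psiE chiE; ring.
by rewrite (distribution_linear T psiE) (distribution_linear T chiE); ring.
Qed.

(** Peels off both linear factors: what remains is $q(d/dt)$ applied to $(d/dt-l)(d/dt-m)T$. *)
Lemma poly_ddt_quadratic (l m : R[i]) q T phi (psi : nat -> testfun R) :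
  (forall k T, T (psi k) = T (D (D (iter k D phi))) + (l + m) * T (D (iter k D phi))
     + l * m * T (iter k D phi)) ->
  poly_ddt (('X - l%:P) * (('X - m%:P) * q)) T phi =
  coeff_sum q (fun k => (-1) ^+ k * T (psi k)).
Proof.
move=> psiE; rewrite poly_ddtE !coeff_sum_XsubC; apply: eq_coeff_sum => k.
by rewrite psiE !exprS /=; ring.
Qed.

(** Over the whole line this is the weak equation for [w]. Over the half-line, [w 0 = 0] kills the
    boundary term in the derivative of [phi], and [cexp m 0 = 1] leaves exactly the Dirac mass. *)
Lemma cintegral_quadratic (l m : R[i]) (w : R -> R[i]) phi (g : R -> R[i]) :
  w 0 = 0 -> (forall t, is_cderive w t (l * w t + cexp m t)) ->
  (forall t, g t = w t * (D (D phi) t + (l + m) * D phi t + l * m * phi t)) ->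
  cintegral g = 0 /\ cintegral (fun t => if t <= 0 then 0 else g t) = phi 0.
Proof.
move=> w0 wd gE; pose psi t := - D phi t - m * phi t.
(* [G] is a primitive of [g], which does both integrations by parts at once. *)
pose G t := - (w t * psi t + cexp m t * phi t).
have psid t : is_cderive psi t (- D (D phi) t - m * D phi t).
  apply: is_cderiveD; first exact/is_cderiveN/testfun_is_cderive.
  exact/is_cderiveN/is_cderiveZ/testfun_is_cderive.
have Gd t : is_cderive G t (g t).
  apply: is_cderive_eq.
    apply: is_cderiveN; apply: is_cderiveD; apply: is_cderiveM.
    - exact: wd.
    - exact: psid.
    - exact: is_cderive_cexp.
    - exact: testfun_is_cderive.
  by rewrite gE /psi; ring.
have gc : continuous (g : R -> R[i]^o).
  have wc := is_cderive_continuous wd.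
  have pc := @testfun_continuous _ phi.
  have pc1 := @testfun_continuous _ (D phi).
  have pc2 := @testfun_continuous _ (D (D phi)).
  have cc := @continuous_ccst R.
  rewrite (_ : g = fun t => w t * (D (D phi) t + (l + m) * D phi t + l * m * phi t)).
    exact: (continuous_cmul wc (continuous_cadd (continuous_cadd pc2
      (continuous_cmul (cc _) pc1)) (continuous_cmul (cc _) pc))).
  exact/funext.
have Gs : compact (csupp G).
  apply: (compact_csupp_sub (@testfun_compact _ phi)).
  apply: csupp_sub_closed => [|t nt]; first exact: closed_closure.
  rewrite /G /psi (csupp_eq0 nt) (@csupp_eq0 _ (D phi) t); first by ring.
  by move=> /csupp_cderive.
have [g0 gG] := cintegral_derive_csupp Gs Gd gc; split=> //.
by rewrite gG /G w0 cexp0; ring.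
Qed.

(** The witness is $t^n\psi$, built by multiplying by $t$ repeatedly:
    $(t\varphi)^{(k+1)}=t\varphi^{(k+1)}+(k+1)\varphi^{(k)}$, evaluated at 0. *)
Lemma testfun_vanishing n psi : exists phi,
  (forall k, (k < n)%N -> iter k D phi 0 = 0) /\ iter n D phi 0 = n`!%:R * psi 0.
Proof.
elim: n => [|n [phi [phi0 phin]]]; first by exists psi; split=> //; rewrite mul1r.
have [chi chiE] := testfun_mul phi (@Cinfty_id R).
have chid k t : iter k.+1 D chi t = t%:C * iter k.+1 D phi t + k.+1%:R * iter k D phi t.
  (* Differentiates a closed form of the [j]-th derivative of [chi]. *)
  have step j (u : R -> R[i]) : (testfun_fun (iter j D chi) = u) ->
      forall z, is_cderive u t z -> iter j.+1 D chi t = z.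
    by move=> jE z /is_cderiveP[_ <-]; rewrite iterS /= jE.
  elim: k t step => [|k IH] t step.
    apply: (step 0%N); first exact/funext/chiE.
    apply: is_cderive_eq.
      by apply: is_cderiveM; [exact: is_cderive_id|exact: testfun_is_cderive].
    by rewrite /=; ring.
  apply: (step k.+1).
    apply/funext => s; apply: IH => j u jE z /is_cderiveP[_ <-].
    by rewrite iterS /= jE.
  apply: is_cderive_eq.
    apply: is_cderiveD.
      by apply: is_cderiveM; [exact: is_cderive_id|exact: testfun_is_cderive].
    by apply: is_cderiveZ; exact: testfun_is_cderive.
  by rewrite [in RHS]iterS -[k.+2]addn1 natrD; ring.
exists chi; split=> [[|k] kn|].
- by rewrite /= chiE mul0r.
- by rewrite chid mul0r add0r phi0// mulr0.
- by rewrite chid mul0r add0r phin mulrA -natrM factS.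
Qed.

End DistributionalEquation.

(** * Degree one against higher degree *)

Section Main.
Variable R : realType.
Implicit Types (p : {poly R[i]}) (u : R -> R[i]).
Local Notation D := (@testfun_deriv R).

(** Integration by parts moves the derivative back to [u], and the fundamental lemma makes the
    equation pointwise. *)
Lemma size2_solution_is_cderive p u : size p = 2%N -> solution_set p u -> C1 u ->
  forall t, is_cderive u t (- (p`_0 / p`_1) * u t).
Proof.
move=> sp [uc usol] [ud u'c] t.
have p1 : p`_1 != 0.
  by rewrite -[1%N]/2.-1 -sp -lead_coefE lead_coef_eq0 -size_poly_eq0 sp.
have cc := @continuous_ccst R.
pose g s := p`_0 * u s + p`_1 * cderive u s.
have gc : continuous (g : R -> R[i]^o).
  exact: (continuous_cadd (continuous_cmul (cc _) uc) (continuous_cmul (cc _) u'c)).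
have g0 : g t = 0.
  apply: fundamental_lemma => // phi.
  (* [psi] will be the adjoint operator applied to [phi], so the weak equation says that [u] times
     [psi] has integral 0. *)
  have [chi chiE] := testfun_mul (D phi) (Cinfty_cst (- p`_1)).
  have [psi psiE] := testfun_lin p`_0 phi chi.
  have upsi : cintegral (fun s => u s * psi s) = 0.
    have := usol phi; rewrite poly_ddtE /coeff_sum sp big_ord_recr big_ord1 /= => <-.
    pose T := regular_distribution uc; rewrite -/T -[LHS]/(T psi).
    (* A zero test function lets the pure multiple [chi] fit the format $a\varphi+\psi$ of
       [distribution_linear]. *)
    have [z zE] := testfun_mul phi (Cinfty_cst 0).
    have zE' s : z s = (-1) * z s + z s by rewrite zE /=; ring.
    have Tz : T z = 0 by rewrite (distribution_linear T zE'); ring.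
    have chiE' s : chi s = - p`_1 * D phi s + z s by rewrite chiE zE /=; ring.
    by rewrite (distribution_linear T psiE) (distribution_linear T chiE') Tz /T /=; ring.
  pose G s := p`_1 * (u s * phi s).
  pose G' s := p`_1 * (cderive u s * phi s + u s * D phi s).
  have Gd s : is_cderive G s (G' s).
    apply: is_cderiveZ; apply: is_cderiveM; last exact: testfun_is_cderive.
    exact: cderivableP.
  have phic := @testfun_continuous _ phi.
  have Dphic := @testfun_continuous _ (D phi).
  have G'c : continuous (G' : R -> R[i]^o).
    exact: (continuous_cmul (cc _)
      (continuous_cadd (continuous_cmul u'c phic) (continuous_cmul uc Dphic))).
  have Gs : compact (csupp G).
    apply: (compact_csupp_sub (@testfun_compact _ phi)).
    exact: subset_trans (@csuppMr _ _ _) (@csuppMr _ _ _).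
  have G's : compact (csupp G').
    by apply: (compact_csupp_sub Gs); rewrite -(cderive_eq Gd); exact: csupp_cderive.
  have ups : compact (csupp (fun s => u s * psi s)).
    exact: compact_csupp_sub (@testfun_compact _ psi) (@csuppMr _ _ _).
  have upc : continuous ((fun s => u s * psi s) : R -> R[i]^o).
    exact: (continuous_cmul uc (@testfun_continuous _ psi)).
  have [G'0 _] := cintegral_derive_csupp Gs Gd G'c.
  (* [g] times [phi] differs from [u] times [psi] by a total derivative of compact support. *)
  rewrite (_ : (fun s => _) = fun s => u s * psi s + G' s).
    by rewrite cintegralD// upsi G'0 addr0.
  by apply/funext => s; rewrite psiE chiE /g /G'; ring.
apply: (is_cderive_eq (cderivableP (ud t))).
apply: (mulfI p1).
have -> : p`_1 * cderive u t = - (p`_0 * u t).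
  by apply/eqP; rewrite -addr_eq0 addrC; exact/eqP.
by field.
Qed.

(** The difference solves a first-order linear equation with initial value 0. *)
Lemma size2_concatenable p : size p = 2%N -> concatenable (solution_set p).
Proof.
move=> sp u v us uC1 vs vC1 uv.
have ud := size2_solution_is_cderive sp us uC1.
have vd := size2_solution_is_cderive sp vs vC1.
have E t : u t + - v t = 0.
  apply: (@linear_ode_eq0 _ (- (p`_0 / p`_1)) (fun s => u s + - v s)) => [s|].
    by apply: (is_cderive_eq (is_cderiveD (ud s) (is_cderiveN (vd s)))); ring.
  by rewrite uv subrr.
rewrite (_ : concatenation u v = u)//; apply/funext => t; rewrite /concatenation.
by case: ifP => // _; apply/esym/eqP; rewrite -subr_eq0 E.
Qed.

Lemma concatenable_size p : (1 < size p)%N -> concatenable (solution_set p) ->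
  (size p <= 2)%N.
Proof.
move=> sp hc; rewrite leqNgt; apply/negP => sp3.
have factor (q : {poly R[i]}) : (1 < size q)%N ->
    exists (l : R[i]) (r : {poly R[i]}), q = ('X - l%:P) * r.
  move=> sq; have sq1 : size q != 1%N by rewrite gtn_eqF.
  have [l /factor_theorem[r qE]] := elimT (closed_rootP q) sq1.
  by exists l, r; rewrite qE mulrC.
have [l [r pE]] := factor p sp.
have r0 : r != 0 by apply: contraTneq sp => r0; rewrite pE r0 mulr0 size_poly0.
have sr : (1 < size r)%N by move: sp3; rewrite pE size_mul ?polyXsubC_eq0 // size_XsubC.
have [m [q rE]] := factor r sr.
have q0 : q != 0 by apply: contraNneq r0 => q0; rewrite rE q0 mulr0.
have [w [w0 wd]] := second_order_solution l m.
have pq : p = ('X - l%:P) * (('X - m%:P) * q) by rewrite pE rE.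
have wc := is_cderive_continuous wd.
(* One adjoint test function for each derivative of [phi], collected by choice. *)
have quad phi : exists psi : nat -> testfun R,
    (forall k t, psi k t = D (D (iter k D phi)) t + (l + m) * D (iter k D phi) t
       + l * m * iter k D phi t) /\
    (forall k (T : distribution R), T (psi k) = T (D (D (iter k D phi))) +
       (l + m) * T (D (iter k D phi)) + l * m * T (iter k D phi)).
  have [psi psiE] := choice (fun k => testfun_quadratic l m (iter k D phi)).
  by exists psi; split=> k; [exact: (psiE k).1|exact: (psiE k).2].
have wsol : solution_set p w.
  exists wc => phi; have [psi [psiE TpsiE]] := quad phi.
  rewrite pq (poly_ddt_quadratic _ _ TpsiE); apply: coeff_sum0 => k.
  rewrite [X in _ * X](_ : _ = 0) ?mulr0//.
  exact: (cintegral_quadratic w0 wd (fun t => congr1 ( *%R (w t)) (psiE k t))).1.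
have wC1 : C1 w.
  split=> [t|]; first by have /is_cderiveP[] := wd t.
  rewrite (cderive_eq wd).
  exact: (continuous_cadd (continuous_cmul (@continuous_ccst _ l) wc)
    (is_cderive_continuous (@is_cderive_cexp _ m))).
have zd (t : R) : is_cderive (fun=> 0 : R[i]) t 0 := is_cderive_cst 0 t.
have zsol : solution_set p (fun=> 0).
  exists (is_cderive_continuous zd) => phi.
  rewrite poly_ddtE; apply: coeff_sum0 => k.
  rewrite [X in _ * X](_ : _ = 0) ?mulr0//.
  (* This zero function is its own derivative, so the integral of a compactly supported derivative
     applies to it. *)
  pose z (t : R) := 0 * iter k D phi t.
  have zs : compact (csupp z).
    exact: compact_csupp_sub (@testfun_compact _ _) (@csuppMr _ _ _).
  have zd' t : is_cderive z t (z t).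
    apply: (is_cderive_eq (is_cderiveZ 0 (testfun_is_cderive (iter k D phi) t))).
    by rewrite /z !mul0r.
  have zc : continuous (z : R -> R[i]^o).
    exact: (continuous_cmul (@continuous_ccst _ 0)
      (@testfun_continuous _ (iter k D phi))).
  exact: (cintegral_derive_csupp zs zd' zc).1.
have zC1 : C1 (fun=> 0 : R[i]).
  split=> [t|]; first by have /is_cderiveP[] := zd t.
  by rewrite (cderive_eq zd); exact: is_cderive_continuous zd.
have [vc vsol] := hc _ _ zsol zC1 wsol wC1 (esym w0).
(* That is, $q(d/dt)$ would annihilate the Dirac mass. *)
have vanish phi : coeff_sum q (fun k => (-1) ^+ k * iter k D phi 0) = 0.
  have [psi [psiE TpsiE]] := quad phi.
  rewrite -[RHS](vsol phi) pq (poly_ddt_quadratic _ _ TpsiE).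
  apply: eq_coeff_sum => k; congr (_ * _).
  have [_ <-] := cintegral_quadratic w0 wd (fun t => congr1 ( *%R (w t)) (psiE k t)).
  rewrite /= /regular_fun; congr cintegral; apply/funext => t.
  by rewrite /concatenation; case: ifP => // _; rewrite mul0r.
have [f [b [fpos _ bE]]] := testfun_bump (-1 : R) 1.
(* At order $\deg q$ only the leading coefficient survives, multiplied by a sign, a factorial and
   [b 0], all nonzero. *)
have [phi [phi0 phin]] := testfun_vanishing (size q).-1 b.
have := vanish phi; rewrite /coeff_sum.
have sq : size q = (size q).-1.+1 by rewrite prednK// size_poly_gt0.
rewrite sq big_ord_recr /= big1 ?add0r; last first.
  by move=> k _; rewrite phi0// !mulr0.
rewrite phin bE; apply/eqP; rewrite !mulf_neq0//.
- by rewrite -lead_coefE lead_coef_eq0.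
- by rewrite expf_neq0// oppr_eq0 oner_eq0.
- by rewrite (inj_eq (@complexI _)) gt_eqF// fpos// ltr01 oppr_lt0 ltr01.
Qed.

End Main.

Theorem theorem2p1 (R : realType) (p : {poly R[i]}) (hp : (1 < size p)%N) :
  concatenable (solution_set p) <-> (size p).-1 = 1%N.
Proof.
split=> [/(concatenable_size hp) sp|sp].
  by rewrite (_ : size p = 2%N)//; apply/eqP; rewrite eqn_leq sp.
by apply: size2_concatenable; rewrite -(ltn_predK hp) sp.
Qed.
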